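(* Let $(K_{i,j})_{i,j\ge1}$ and $(J_{i,j})_{i,j\ge 1}$ be real numbers with $0\le K_{i,j}=K_{j,i}$ and $0\le J_{i,j}=J_{j,i}$ for all $i,j\ge1$. Assume there exist non-negative real sequences $(\rho_i)_{i\ge1}$ and $(\beta_{i,j})_{i,j\ge1}$ such that $K_{i,j}=\rho_i\rho_j+\beta_{i,j}$ for all $i,j\ge1$, that $\inf_{i\ge1}\frac{\rho_i}{i}=S>0$, that for some $\kappa>0$ one has $\beta_{i,j}\le\kappa\rho_i\rho_j$ for all $i,j\ge1$, and that $J_{i,j}\le\rho_i\rho_j$ for all $i,j\ge1$. Let $a^0,b^0\in X_0^+$, and let $(a,b)$ be a solution on $[0,\infty)$ of the coagulation--annihilation system with rates $K$, $J$ and initial data $(a^0,b^0)$ that is constructed as a limit of truncated solutions (see context). Then $$\lim_{t\to\infty}\|a(t)\|_1=0\qquad\text{and}\qquad\lim_{t\to\infty}\|b(t)\|_1=0 .$$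
   Context: For $p\in\mathbb{R}$, $X_p$ is the space of real sequences $x=(x_i)_{i\ge1}$ with $\|x\|_p=\sum_{i=1}^\infty i^p|x_i|<\infty$, and $X_p^+=\{x\in X_p: x_i\ge0\text{ for all }i\ge1\}$. The coagulation--annihilation system is, for $i\in\mathbb{N}=\{1,2,\dots\}$ and $t>0$, $$\frac{da_i}{dt}=\frac12\sum_{j=1}^{i-1}K_{j,i-j}a_ja_{i-j}-\sum_{j=1}^\infty K_{i,j}a_ia_j-\sum_{j=1}^\infty J_{i,j}a_ib_j,\qquad \frac{db_i}{dt}=\frac12\sum_{j=1}^{i-1}K_{j,i-j}b_jb_{i-j}-\sum_{j=1}^\infty K_{i,j}b_ib_j-\sum_{j=1}^\infty J_{i,j}b_ia_j,$$ with $a_i(0)=a_i^0\ge0$, $b_i(0)=b_i^0\ge0$ (for $i=1$ the first sums are zero). Solution: a pair $(a,b)=((a_i)_{i\ge1},(b_i)_{i\ge1})$ of sequences of non-negative functions is a solution on $[0,\infty)$ with initial data $(a^0,b^0)$ if (1) $a_i,b_i\in C([0,\infty))$ for each $i$; (2) for each $i$ and $t\ge0$, the functions $\sum_{j}K_{i,j}a_j$, $\sum_{j}K_{i,j}b_j$, $\sum_{j}J_{i,j}a_j$, $\sum_{j}J_{i,j}b_j$ belong to $L^1(0,t)$; (3) for each $i$ and $t>0$, $$a_i(t)=a_i^0+\int_0^t\Big(\tfrac12\sum_{j=1}^{i-1}K_{j,i-j}a_j(s)a_{i-j}(s)-a_i(s)\sum_{j=1}^\infty K_{i,j}a_j(s)-a_i(s)\sum_{j=1}^\infty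 J_{i,j}b_j(s)\Big)ds,$$ $$b_i(t)=b_i^0+\int_0^t\Big(\tfrac12\sum_{j=1}^{i-1}K_{j,i-j}b_j(s)b_{i-j}(s)-b_i(s)\sum_{j=1}^\infty K_{i,j}b_j(s)-b_i(s)\sum_{j=1}^\infty J_{i,j}a_j(s)\Big)ds.$$ Truncated system: for $N\ge2$, $((a_i^N)_{1\le i\le2N},(b_i^N)_{1\le i\le2N})$ denotes the unique non-negative solution on $[0,\infty)$ of $$\frac{da_i^N}{dt}=\frac12\sum_{j=1}^{i-1}K_{j,i-j}a_j^Na_{i-j}^N-\sum_{j=1}^NK_{i,j}a_i^Na_j^N-\sum_{j=1}^NJ_{i,j}a_i^Nb_j^N,\ 1\le i\le N;\qquad \frac{da_i^N}{dt}=\frac12\sum_{j=i-N}^NK_{j,i-j}a_j^Na_{i-j}^N,\ N+1\le i\le2N;$$ the same equations with the roles of $a^N$ and $b^N$ exchanged; and $a_i^N(0)=a_i^0$, $b_i^N(0)=b_i^0$ for $1\le i\le2N$. A solution $(a,b)$ is ''constructed as a limit of truncated solutions'' if there is a strictly increasing sequence of integers $(N_p)_{p\ge1}$ such that, for each $i\ge1$ and $T>0$, $a_i^{N_p}\to a_i$ and $b_i^{N_p}\to b_i$ uniformly on $[0,T]$ as $p\to\infty$. *)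

(* Defs.v *)
From HB Require Import structures.
From mathcomp Require Import all_boot all_order all_algebra.
From mathcomp Require Import all_classical all_reals all_analysis.
Import Order.TTheory GRing.Theory Num.Theory.
Import numFieldNormedType.Exports.

Set Implicit Arguments.
Unset Strict Implicit.
Unset Printing Implicit Defensive.

Local Open Scope classical_set_scope.
Local Open Scope ring_scope.

(* Cluster sizes range over i >= 1.  Sequences are functions on nat whose value
   at 0 is never used; likewise functions of time are functions on R whose
   values at t < 0 are never used. *)

(* Extended-real valued, so that finiteness of the norm is part of what is
   asserted when it is compared with, or converges to, a real number. *)
Definition xnorm (R : realType) (p : R) (x : nat -> R) : \bar R :=
  (\sum_(1 <= i <oo) ((i%:R `^ p) * `|x i|)%:E)%E.

Definition Xspace (R : realType) (p : R) : set (nat -> R) :=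
  [set x | (xnorm p x < +oo)%E].

Definition Xplus (R : realType) (p : R) : set (nat -> R) :=
  [set x | Xspace p x /\ forall i, (0 < i)%N -> 0 <= x i].

(* The a-equation; the b-equation is obtained by exchanging the last two
   families.  The infinite sums have non-negative terms and may be +oo on a
   Lebesgue-null set of times, hence the value in \bar R. *)
Definition coag_annih_rhs (R : realType) (K J : nat -> nat -> R)
    (a b : nat -> R -> R) (i : nat) (s : R) : \bar R :=
  ((2^-1 * \sum_(1 <= j < i) K j (i - j)%N * a j s * a (i - j)%N s)%:E
   - (a i s)%:E * (\sum_(1 <= j <oo) (K i j * a j s)%:E)
   - (a i s)%:E * (\sum_(1 <= j <oo) (J i j * b j s)%:E))%E.

Definition L1 (R : realType) (t : R) (f : R -> \bar R) : Prop :=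
  (@lebesgue_measure R).-integrable `]0, t[ f.

Record solution (R : realType) (K J : nat -> nat -> R) (a0 b0 : nat -> R)
    (a b : nat -> R -> R) : Prop := Solution {
  sol_ge0 : forall i, (0 < i)%N -> forall t : R, 0 <= t ->
    0 <= a i t /\ 0 <= b i t;
  sol_continuous : forall i, (0 < i)%N ->
    {within `[0, +oo[, continuous (a i)} /\
    {within `[0, +oo[, continuous (b i)};
  sol_integrable : forall i, (0 < i)%N -> forall t : R, 0 <= t ->
    [/\ L1 t (fun s => \sum_(1 <= j <oo) (K i j * a j s)%:E)%E,
        L1 t (fun s => \sum_(1 <= j <oo) (K i j * b j s)%:E)%E,
        L1 t (fun s => \sum_(1 <= j <oo) (J i j * a j s)%:E)%E &
        L1 t (fun s => \sum_(1 <= j <oo) (J i j * b j s)%:E)%E];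
  sol_eq : forall i, (0 < i)%N -> forall t : R, 0 < t ->
    ((a i t)%:E = (a0 i)%:E +
       \int[@lebesgue_measure R]_(s in `[0%R, t]) coag_annih_rhs K J a b i s)%E
    /\
    ((b i t)%:E = (b0 i)%:E +
       \int[@lebesgue_measure R]_(s in `[0%R, t]) coag_annih_rhs K J b a i s)%E
}.

Definition trunc_rhs (R : realType) (K J : nat -> nat -> R) (N : nat)
    (a b : nat -> R -> R) (i : nat) (t : R) : R :=
  if (i <= N)%N then
    2^-1 * \sum_(1 <= j < i) K j (i - j)%N * a j t * a (i - j)%N t
    - \sum_(1 <= j < N.+1) K i j * a i t * a j t
    - \sum_(1 <= j < N.+1) J i j * a i t * b j t
  else
    2^-1 * \sum_(i - N <= j < N.+1) K j (i - j)%N * a j t * a (i - j)%N t.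

(* The truncated system has exactly one such solution (up to the unused values
   at i = 0, i > 2N and t < 0), so this predicate determines it.  Together with
   continuity on [0, +oo[, the equation for t > 0 yields the one-sided one at
   t = 0. *)
Record truncated_solution (R : realType) (K J : nat -> nat -> R) (N : nat)
    (a0 b0 : nat -> R) (a b : nat -> R -> R) : Prop := TruncatedSolution {
  tsol_ge0 : forall i, (1 <= i <= 2 * N)%N -> forall t : R, 0 <= t ->
    0 <= a i t /\ 0 <= b i t;
  tsol_continuous : forall i, (1 <= i <= 2 * N)%N ->
    {within `[0, +oo[, continuous (a i)} /\
    {within `[0, +oo[, continuous (b i)};
  tsol_init : forall i, (1 <= i <= 2 * N)%N -> a i 0 = a0 i /\ b i 0 = b0 i;
  tsol_ode : forall i, (1 <= i <= 2 * N)%N -> forall t : R, 0 < t ->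
    is_derive t 1 (a i) (trunc_rhs K J N a b i t) /\
    is_derive t 1 (b i) (trunc_rhs K J N b a i t)
}.

Definition limit_of_truncated (R : realType) (K J : nat -> nat -> R)
    (a0 b0 : nat -> R) (a b : nat -> R -> R) : Prop :=
  exists aN bN : nat -> nat -> R -> R,
    (forall N, (2 <= N)%N ->
       truncated_solution K J N a0 b0 (aN N) (bN N)) /\
  exists Np : nat -> nat,
    [/\ forall p, (2 <= Np p)%N,
        {homo Np : p q / (p < q)%N} &
        forall i, (0 < i)%N -> forall T : R, 0 < T ->
          {uniform `[0, T], (fun p => aN (Np p) i) @ \oo --> a i} /\
          {uniform `[0, T], (fun p => bN (Np p) i) @ \oo --> b i}].

(* Main.v *)
(* In the N-truncated system let F and M be the number and the mass of the
   a-clusters of size at most N.  Coagulation and annihilation cannot increase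
   M, while K_ij >= S^2 i j gives F' <= - S^2 M^2 / 2.  Since M is nonincreasing,
   integrating over [0, t] yields S^2 t M(t)^2 <= 2 F(0) <= 2 ||a0||_0, uniformly
   in N.  The bound passes to the limit for every finite partial sum of the
   mass, hence ||a(t)||_1 = O(t^(-1/2)), and likewise for b by symmetry. *)
Require Import Defs.
From HB Require Import structures.
From mathcomp Require Import all_boot all_order all_algebra.
From mathcomp Require Import all_classical all_reals all_analysis.
From mathcomp Require Import ring lra zify.
Import Order.TTheory GRing.Theory Num.Theory.
Import numFieldNormedType.Exports.
Local Open Scope classical_set_scope.
Local Open Scope ring_scope.

(** * Rearrangements of double sums *)

(** With [k = i - j] the left side runs over the pairs [(j, k)] such that [j + k <= N], a triangle
    inside the square; the remaining terms are non-negative. *)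
Lemma sum_triangle_le_square (R : realType) (N : nat) (f : nat -> nat -> R) :
  (forall i j, (1 <= i <= N)%N -> (1 <= j <= N)%N -> 0 <= f i j) ->
  \sum_(1 <= i < N.+1) \sum_(1 <= j < i) f j (i - j)%N <=
  \sum_(1 <= i < N.+1) \sum_(1 <= j < N.+1) f i j.
Proof.
move=> f_ge0.
have -> : \sum_(1 <= i < N.+1) \sum_(1 <= j < i) f j (i - j)%N =
    \sum_(1 <= j < N.+1) \sum_(j.+1 <= i < N.+1) f j (i - j)%N.
  rewrite (eq_big_nat _ _ (F2 := fun i =>
      \sum_(1 <= j < N.+1 | (j < i)%N) f j (i - j)%N)); last first.
    by move=> i /andP[_ iN]; rewrite (big_nat_widen _ _ _ _ _ (ltnW iN)).
  rewrite (exchange_big_dep_nat xpredT)//=.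
  apply: eq_big_nat => j /andP[j1 jN].
  by rewrite [RHS](big_nat_widenl _ 1%N)//.
apply: ler_sum_nat => j /andP[j1 jN].
rewrite -{1}[j.+1]add1n big_addn.
under eq_big_nat do rewrite addnK.
rewrite [leRHS](@big_cat_nat _ _ _ (N.+1 - j)%N)//=; [|lia|lia].
rewrite lerDl big_nat_cond; apply: sumr_ge0 => k; rewrite andbT => hk.
by apply: f_ge0; lia.
Qed.

Lemma sum_swap_weight (R : realType) (N : nat) (w : nat -> R) (f : nat -> nat -> R) :
  (forall i j, (0 < i)%N -> (0 < j)%N -> f i j = f j i) ->
  \sum_(1 <= i < N.+1) \sum_(1 <= j < N.+1) w j * f i j =
  \sum_(1 <= i < N.+1) \sum_(1 <= j < N.+1) w i * f i j.
Proof.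
move=> f_sym; rewrite exchange_big_nat.
apply: eq_big_nat => i /andP[i1 _]; apply: eq_big_nat => j /andP[j1 _].
by rewrite f_sym.
Qed.

Lemma truncated_solution_swap (R : realType) (K J : nat -> nat -> R) (N : nat)
    (a0 b0 : nat -> R) (a b : nat -> R -> R) :
  truncated_solution K J N a0 b0 a b -> truncated_solution K J N b0 a0 b a.
Proof.
move=> [ge0 cont init ode]; split=> *; apply/and_comm.
- exact: ge0.
- exact: cont.
- exact: init.
- exact: ode.
Qed.

(** * Estimates for the truncated system *)

Section truncated.
Context {R : realType} (K J : nat -> nat -> R) (N : nat) (a0 b0 : nat -> R).
Context (a b : nat -> R -> R).
Context (K_ge0 : forall i j, (0 < i)%N -> (0 < j)%N -> 0 <= K i j).
Context (K_sym : forall i j, (0 < i)%N -> (0 < j)%N -> K i j = K j i).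
Context (J_ge0 : forall i j, (0 < i)%N -> (0 < j)%N -> 0 <= J i j).
Context (ab : truncated_solution K J N a0 b0 a b).

(* Only sizes up to N are counted: the clusters of sizes N+1..2N are inert, so
   their mass does not decay. *)
Let moment (w : nat -> R) (t : R) : R := \sum_(1 <= i < N.+1) w i * a i t.

Lemma is_derive_moment (w : nat -> R) (t : R) : 0 < t ->
  is_derive t 1 (moment w)
    (\sum_(1 <= i < N.+1) w i * trunc_rhs K J N a b i t).
Proof.
move=> t0; rewrite /moment.
(* The upper end of the sum is separated from [N], which also occurs in [trunc_rhs] and must stay
   fixed during the induction. *)
suff H n : (n <= 2 * N)%N ->
    is_derive t 1 (fun t => \sum_(1 <= i < n.+1) w i * a i t)
      (\sum_(1 <= i < n.+1) w i * trunc_rhs K J N a b i t).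
  by apply: H; lia.
elim: n => [|n IH] nN.
  rewrite big_geq//; under eq_fun do rewrite big_geq//.
  exact: is_derive_cst.
rewrite big_nat_recr//=; under eq_fun do rewrite big_nat_recr//=.
have ? := IH (ltnW nN).
have [? _] : is_derive t 1 (a n.+1) (trunc_rhs K J N a b n.+1 t) /\
  is_derive t 1 (b n.+1) (trunc_rhs K J N b a n.+1 t).
  exact: tsol_ode ab _ _ _ t0.
apply: is_deriveD.
Qed.

Lemma continuous_moment (w : nat -> R) :
  {within `[0, +oo[, continuous (moment w)}.
Proof.
rewrite /moment => x.
suff H n : (n <= 2 * N)%N ->
    {for x, continuous
      ((fun t => \sum_(1 <= i < n.+1) w i * a i t) : subspace `[0, +oo[ -> R)}.
  by apply: H; lia.
elim: n => [|n IH] nN.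
  have -> : (fun t => \sum_(1 <= i < 1) w i * a i t) = cst 0.
    by apply/funext => t; rewrite big_geq.
  exact: cvg_cst.
have -> : (fun t => \sum_(1 <= i < n.+2) w i * a i t) =
    (fun t => \sum_(1 <= i < n.+1) w i * a i t + w n.+1 * a n.+1 t).
  by apply/funext => t; rewrite big_nat_recr.
apply: cvgD; first exact: IH (ltnW nN).
apply: cvgMr.
have [+ _] : {within `[0, +oo[, continuous (a n.+1)} /\
  {within `[0, +oo[, continuous (b n.+1)} by exact: tsol_continuous ab _ _.
by apply.
Qed.

(** Mean value theorem. The equation is available only for [t > 0], so at [u = 0] continuity on the
    closed interval takes over. *)
Lemma moment_increment_le (w : nat -> R) (c u v : R) : 0 <= u -> u <= v ->
  (forall t, u < t -> t < v ->
    \sum_(1 <= i < N.+1) w i * trunc_rhs K J N a b i t <= c) ->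
  moment w v - moment w u <= c * (v - u).
Proof.
move=> u0; rewrite le_eqVlt => /predU1P[<-|uv] rhs_le.
  by rewrite !subrr mulr0.
have cont : {within `[u, v], continuous (moment w)}.
  apply: continuous_subspaceW (continuous_moment w) => x /=.
  by rewrite !in_itv/= andbT => /andP[/(le_trans u0)].
have [|x /[!in_itv]/= /andP[ux xv] ->] := MVT uv (df := fun t =>
    \sum_(1 <= i < N.+1) w i * trunc_rhs K J N a b i t) _ cont.
  move=> x /[!in_itv]/= /andP[ux xv].
  exact: is_derive_moment (le_lt_trans u0 ux).
by rewrite ler_wpM2r ?subr_ge0 ?(ltW uv)// rhs_le.
Qed.

(** Weak form of the equation: a coagulation replaces [w i + w j] by [w (i + j)], and [2^-1]
    compensates for counting ordered pairs. It is only an inequality because annihilation is dropped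
    and clusters of size [i + j > N], which leave the counted range, are kept as gains. *)
Lemma moment_rhs_le (w : nat -> R) (t : R) :
  (forall i, (0 < i)%N -> 0 <= w i) -> 0 <= t ->
  \sum_(1 <= i < N.+1) w i * trunc_rhs K J N a b i t <=
  2^-1 * \sum_(1 <= i < N.+1) \sum_(1 <= j < N.+1)
    (w (i + j)%N - w i - w j) * (K i j * a i t * a j t).
Proof.
move=> w_ge0 t0.
have a_ge0 i : (1 <= i < N.+1)%N -> 0 <= a i t.
  by move=> hi; have [] := tsol_ge0 ab (i := i) _ t0; first lia.
have b_ge0 i : (1 <= i < N.+1)%N -> 0 <= b i t.
  by move=> hi; have [] := tsol_ge0 ab (i := i) _ t0; first lia.
pose G i j := K i j * a i t * a j t.
have G_sym i j : (0 < i)%N -> (0 < j)%N -> G i j = G j i.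
  by move=> i0 j0; rewrite /G K_sym// mulrAC.
(* By symmetry of [G] the losses weighted by [w i] and by [w j] have equal sums, so together they
   cancel the factor [2^-1]. *)
have -> : 2^-1 * \sum_(1 <= i < N.+1) \sum_(1 <= j < N.+1)
      (w (i + j)%N - w i - w j) * (K i j * a i t * a j t) =
    2^-1 * \sum_(1 <= i < N.+1) \sum_(1 <= j < N.+1) w (i + j)%N * G i j
    - \sum_(1 <= i < N.+1) \sum_(1 <= j < N.+1) w i * G i j.
  under eq_bigr do (under eq_bigr do rewrite !mulrBl; rewrite !sumrB).
  by rewrite !sumrB (sum_swap_weight _ _ _ _ G_sym); field.
have wG_ge0 i j : (1 <= i <= N)%N -> (1 <= j <= N)%N -> 0 <= w (i + j)%N * G i j.
  move=> hi hj; rewrite mulr_ge0 ?w_ge0 ?mulr_ge0 ?K_ge0 ?a_ge0//; lia.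
have := sum_triangle_le_square _ _ _ wG_ge0.
rewrite -(ler_pM2l (x := 2^-1)) ?invr_gt0// => le_gain.
apply: le_trans (lerB le_gain (lexx _)).
rewrite mulr_sumr -sumrB; apply: ler_sum_nat => i hi.
rewrite /trunc_rhs; have -> : (i <= N)%N by lia.
rewrite -mulr_sumr -[leRHS]subr0.
have -> : \sum_(1 <= j < i) w (j + (i - j))%N * G j (i - j)%N =
    w i * \sum_(1 <= j < i) G j (i - j)%N.
  by rewrite mulr_sumr; apply: eq_big_nat => j hj; rewrite subnKC//; lia.
have : 0 <= w i * \sum_(1 <= j < N.+1) J i j * a i t * b j t.
  rewrite mulr_ge0 ?w_ge0//; first lia.
  rewrite big_nat_cond sumr_ge0// => j /andP[hj _].
  by rewrite !mulr_ge0 ?J_ge0 ?a_ge0 ?b_ge0//; lia.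
rewrite /G; lra.
Qed.

Lemma truncated_mass_nonincreasing (u v : R) : 0 <= u -> u <= v ->
  moment (fun i => i%:R) v <= moment (fun i => i%:R) u.
Proof.
move=> u0 uv; rewrite -subr_le0 -(mul0r (v - u)).
apply: moment_increment_le => // t ut _.
apply: le_trans (moment_rhs_le (fun i => i%:R) t _ _) _ => //.
  exact: le_trans u0 (ltW ut).
(* The weight [i] is additive, so every coefficient [w (i + j) - w i - w j] vanishes. *)
rewrite big1 ?mulr0// => i _; rewrite big1// => j _.
by rewrite natrD -addrA -opprD subrr mul0r.
Qed.

Lemma truncated_mass_bound (S t : R) : 0 <= S ->
  (forall i j, (0 < i)%N -> (0 < j)%N -> S ^+ 2 * (i%:R * j%:R) <= K i j) ->
  0 <= t ->
  S ^+ 2 * t * (\sum_(1 <= i < N.+1) i%:R * a i t) ^+ 2 <=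
  2 * \sum_(1 <= i < N.+1) a0 i.
Proof.
move=> S0 K_ge t0; pose M := moment (fun i => i%:R).
rewrite -[\sum_(1 <= i < N.+1) i%:R * a i t]/(M t).
have a_ge0 s i : 0 <= s -> (1 <= i < N.+1)%N -> 0 <= a i s.
  by move=> s0 hi; have [] := tsol_ge0 ab (i := i) _ s0; first lia.
have M_ge0 s : 0 <= s -> 0 <= M s.
  move=> s0; rewrite /M /moment big_nat_cond sumr_ge0// => i /andP[hi _].
  by rewrite mulr_ge0// a_ge0.
(* The increment bound wants one rate for the whole interval; the mass at the final time [t], the
   smallest on [[0, t]], provides it. *)
have := moment_increment_le (fun=> 1) (- (2^-1 * (S ^+ 2 * M t ^+ 2))) 0 t
  (lexx _) t0.
have -> : moment (fun=> 1) 0 = \sum_(1 <= i < N.+1) a0 i.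
  apply: eq_big_nat => i hi; rewrite mul1r.
  by have [] := tsol_init ab (i := i) _; first lia.
have : 0 <= moment (fun=> 1) t.
  rewrite /moment big_nat_cond sumr_ge0// => i /andP[hi _].
  by rewrite mul1r a_ge0.
suff H s : 0 < s -> s < t ->
    \sum_(1 <= i < N.+1) 1 * trunc_rhs K J N a b i s <=
    - (2^-1 * (S ^+ 2 * M t ^+ 2)).
  by move=> F_ge0 /(_ H); lra.
move=> s0 st; apply: le_trans (moment_rhs_le (fun=> 1) _ _ (ltW s0)) _ => //.
rewrite -mulrN ler_pM2l ?invr_gt0//.
apply: (@le_trans _ _ (- (S ^+ 2 * M s ^+ 2))); last first.
  rewrite lerN2 ler_wpM2l ?sqr_ge0// lerXn2r ?nnegrE ?M_ge0 ?(ltW s0)//.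
  exact: truncated_mass_nonincreasing (ltW s0) (ltW st).
rewrite lerNr -sumrN [M s ^+ 2]expr2 /M /moment big_distrlr/= mulr_sumr.
apply: ler_sum_nat => i hi; rewrite -sumrN mulr_sumr.
apply: ler_sum_nat => j hj.
(* For the weight 1 the coefficient is [1 - 1 - 1 = -1]: each coagulation removes one cluster. *)
rewrite subrr sub0r mulN1r opprK -[leRHS]mulrA.
rewrite [leLHS](_ : _ = S ^+ 2 * (i%:R * j%:R) * (a i s * a j s));
  last by ring.
have [i0 j0] : (0 < i)%N /\ (0 < j)%N by lia.
by rewrite ler_wpM2r ?K_ge// mulr_ge0// a_ge0// ltW.
Qed.

End truncated.

(** * Norms, partial sums and pointwise limits *)

Lemma xnorm1_le_of_partial (R : realType) (x : nat -> R) (c : R) :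
  (forall i, (0 < i)%N -> 0 <= x i) ->
  (forall L, \sum_(1 <= i < L.+1) i%:R * x i <= c) -> (xnorm 1 x <= c%:E)%E.
Proof.
move=> x_ge0 part_le; apply: lime_le.
  by apply: is_cvg_ereal_nneg_natsum => i _; rewrite lee_fin mulr_ge0 ?powR_ge0.
near=> n; have n1 : (0 < n)%N by near: n; exact: nbhs_infty_gt.
(* The [n]-th partial sum of the series stops at size [n - 1], hence the bound at [n.-1]. *)
rewrite -(prednK n1) sumEFin lee_fin; apply: le_trans (part_le n.-1).
by apply: ler_sum_nat => i /andP[i0 _]; rewrite powRr1// ger0_norm// x_ge0.
Unshelve. all: by end_near. Qed.

(** Makes the bound on the initial number of clusters independent of the truncation level. *)
Lemma partial_le_xnorm0 (R : realType) (x : nat -> R) (N : nat) :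
  Xplus 0 x -> \sum_(1 <= i < N.+1) x i <= fine (xnorm 0 x).
Proof.
move=> [x_fin x_ge0]; rewrite -lee_fin.
have xn0 : (0 <= xnorm 0 x)%E.
  by apply: nneseries_ge0 => i _ _; rewrite lee_fin mulr_ge0 ?powR_ge0.
rewrite fineK ?ge0_fin_numE//.
apply: le_trans (nneseries_lim_ge N.+1 _); last first.
  by move=> i _ _; rewrite lee_fin mulr_ge0 ?powR_ge0.
rewrite !sumEFin lee_fin; apply: ler_sum_nat => i /andP[i0 _].
by rewrite powRr0 mul1r ger0_norm// x_ge0.
Qed.

(** On the singleton of [x], uniform convergence is convergence at [x]. *)
Lemma uniform_cvg_at (U : choiceType) (V : uniformType) (A : set U)
    (F : set_system (U -> V)) (f : U -> V) (x : U) :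
  Filter F -> A x -> {uniform A, F --> f} -> g x @[g --> F] --> f x.
Proof.
move=> FF Ax f_cvg; rewrite -uniform_set1.
by apply: uniform_subset_cvg f_cvg => _ ->.
Qed.

(** * Passage to the limit and decay of the mass *)

(** Stated for one species, so that it applies to [a] and, after exchanging the roles, to [b]. The
    limits are taken in order: [p] to infinity with [L] fixed, then all [L], then [t]. *)
Lemma cvg_mass0 (R : realType) (K J : nat -> nat -> R) (S : R)
    (a0 b0 : nat -> R) (a : nat -> R -> R) (N : nat -> nat)
    (aN bN : nat -> nat -> R -> R) :
  (forall i j, (0 < i)%N -> (0 < j)%N -> 0 <= K i j) ->
  (forall i j, (0 < i)%N -> (0 < j)%N -> K i j = K j i) ->
  (forall i j, (0 < i)%N -> (0 < j)%N -> 0 <= J i j) ->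
  0 < S ->
  (forall i j, (0 < i)%N -> (0 < j)%N -> S ^+ 2 * (i%:R * j%:R) <= K i j) ->
  Xplus 0 a0 ->
  (forall i, (0 < i)%N -> forall t, 0 <= t -> 0 <= a i t) ->
  {homo N : p q / (p < q)%N} ->
  (forall p, truncated_solution K J (N p) a0 b0 (aN p) (bN p)) ->
  (forall i t, (0 < i)%N -> 0 < t -> aN p i t @[p --> \oo] --> a i t) ->
  xnorm 1 (a ^~ t) @[t --> +oo] --> 0%E.
Proof.
move=> K_ge0 K_sym J_ge0 S0 K_ge a0X a_ge0 N_incr aN_sol aN_cvg.
(* Guarantees that sizes up to [L] lie in the truncated range as soon as [p >= L]. *)
have N_ge p : (p <= N p)%N.
  by elim: p => // p /leq_ltn_trans; apply; exact: N_incr.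
(* [B t] is the non-negative root [m] of [S ^+ 2 * t * m ^+ 2 = 2 * C]; it depends neither on [L]
   nor on [p]. *)
set C := fine (xnorm 0 a0).
pose B t := Num.sqrt (2 * C / S ^+ 2 / t).
have part_le t L : 0 < t -> \sum_(1 <= i < L.+1) i%:R * a i t <= B t.
  move=> t0.
  have : \sum_(1 <= i < L.+1) i%:R * aN p i t @[p --> \oo] -->
      \sum_(1 <= i < L.+1) i%:R * a i t.
    elim: L => [|L IH].
      rewrite big_geq//; under eq_cvg do rewrite big_geq//.
      exact: cvg_cst.
    rewrite big_nat_recr//=; under eq_cvg do rewrite big_nat_recr//=.
    by apply: cvgD => //; apply: cvgMr; exact: aN_cvg.
  move=> /cvgr_to_le; apply; near=> p.
  have Lp : (L <= p)%N by near: p; exact: nbhs_infty_ge.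
  have aN_ge0 i : (1 <= i < (N p).+1)%N -> 0 <= i%:R * aN p i t.
    move=> hi; rewrite mulr_ge0//.
    by have [] := tsol_ge0 (aN_sol p) (i := i) _ (ltW t0); first lia.
  (* The partial sum is enlarged to the whole mass of sizes up to [N p], to which the truncated
     bound applies. *)
  apply: (@le_trans _ _ (\sum_(1 <= i < (N p).+1) i%:R * aN p i t)).
    rewrite [leRHS](@big_cat_nat _ _ _ L.+1)//=; last first.
      exact: leq_trans (N_ge p).
    rewrite lerDl big_nat_cond sumr_ge0// => i /andP[hi _].
    by rewrite aN_ge0//; lia.
  have mass := truncated_mass_bound _ _ _ _ _ _ _ K_ge0 K_sym J_ge0
    (aN_sol p) _ _ (ltW S0) K_ge (ltW t0).
  have m0 : 0 <= \sum_(1 <= i < (N p).+1) i%:R * aN p i t.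
    by rewrite big_nat_cond sumr_ge0// => i /andP[hi _]; rewrite aN_ge0.
  rewrite -(ger0_norm m0) -sqrtr_sqr ler_wsqrtr// -mulrA -invfM ler_pdivlMr.
    rewrite mulrC (le_trans mass)// ler_pM2l//.
    exact: partial_le_xnorm0.
  by rewrite mulr_gt0// exprn_gt0.
have B_cvg : (B t)%:E @[t --> +oo] --> 0%E.
  apply: cvg_EFin; first by near=> t.
  rewrite -[X in _ --> X](sqrtr0 R).
  apply: (cvg_comp (fun t : R => 2 * C / S ^+ 2 / t) Num.sqrt);
    last exact: sqrt_continuous.
  rewrite -(mulr0 (2 * C / S ^+ 2)); apply: cvgMr.
  by apply/(gtr0_cvgV0 (f := id)) => //; exact: nbhs_pinfty_gt.
apply: (squeeze_cvge _ (cvg_cst 0%E) B_cvg).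
near=> t; have t0 : 0 < t by near: t; exact: nbhs_pinfty_gt.
apply/andP; split.
  by apply: nneseries_ge0 => i _ _; rewrite lee_fin mulr_ge0 ?powR_ge0.
apply: xnorm1_le_of_partial => [i i0|L]; last exact: part_le.
by apply: a_ge0 => //; exact: ltW.
Unshelve. all: by end_near. Qed.

Theorem proposition7p1 (R : realType)
    (K J : nat -> nat -> R)
    (K_ge0 : forall i j, (0 < i)%N -> (0 < j)%N -> 0 <= K i j)
    (K_sym : forall i j, (0 < i)%N -> (0 < j)%N -> K i j = K j i)
    (J_ge0 : forall i j, (0 < i)%N -> (0 < j)%N -> 0 <= J i j)
    (J_sym : forall i j, (0 < i)%N -> (0 < j)%N -> J i j = J j i)
    (rho : nat -> R) (beta : nat -> nat -> R) (S kappa : R)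
    (rho_ge0 : forall i, (0 < i)%N -> 0 <= rho i)
    (beta_ge0 : forall i j, (0 < i)%N -> (0 < j)%N -> 0 <= beta i j)
    (K_eq : forall i j, (0 < i)%N -> (0 < j)%N ->
       K i j = rho i * rho j + beta i j)
    (rho_inf : inf [set rho i / i%:R | i in [set i : nat | (0 < i)%N]] = S)
    (S_gt0 : 0 < S)
    (kappa_gt0 : 0 < kappa)
    (beta_le : forall i j, (0 < i)%N -> (0 < j)%N ->
       beta i j <= kappa * rho i * rho j)
    (J_le : forall i j, (0 < i)%N -> (0 < j)%N -> J i j <= rho i * rho j)
    (a0 b0 : nat -> R) (a0_X : Xplus 0 a0) (b0_X : Xplus 0 b0)
    (a b : nat -> R -> R)
    (ab_sol : solution K J a0 b0 a b)
    (ab_lim : limit_of_truncated K J a0 b0 a b) :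
  xnorm 1 (a ^~ t) @[t --> +oo] --> 0%E /\
  xnorm 1 (b ^~ t) @[t --> +oo] --> 0%E.
Proof.
have S_le i : (0 < i)%N -> S * i%:R <= rho i.
  move=> i0; rewrite -ler_pdivlMr ?ltr0n// -rho_inf.
  apply: ge_inf; last by exists i.
  (* [ge_inf] asks for a lower bound of the set of ratios; 0 is one because [rho] is
     non-negative. *)
  by exists 0 => _ [j j0 <-]; rewrite divr_ge0// rho_ge0.
have K_ge i j : (0 < i)%N -> (0 < j)%N -> S ^+ 2 * (i%:R * j%:R) <= K i j.
  move=> i0 j0; rewrite K_eq// expr2 mulrACA.
  apply: (@le_trans _ _ (rho i * rho j)); last by rewrite lerDl beta_ge0.
  by apply: ler_pM; rewrite ?S_le// mulr_ge0// ltW.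
have [aN [bN [N_sol [Np [Np2 Np_incr N_cvg]]]]] := ab_lim.
have ptw i t : (0 < i)%N -> 0 < t ->
    aN (Np p) i t @[p --> \oo] --> a i t /\ bN (Np p) i t @[p --> \oo] --> b i t.
  move=> i0 t0; have [acvg bcvg] := N_cvg i i0 t t0.
  have tt : [set` `[0, t]] t by rewrite /= in_itv/= lexx ltW.
  split; first exact: (uniform_cvg_at _ _ _ _ _ t _ tt acvg).
  exact: (uniform_cvg_at _ _ _ _ _ t _ tt bcvg).
split.
  apply: (cvg_mass0 _ K J S a0 b0 a Np (aN \o Np) (bN \o Np)) => //.
  - by move=> i i0 t /(sol_ge0 ab_sol i0)[].
  - by move=> p; exact: N_sol.
  - by move=> i t i0 /(ptw i t i0)[].
(* The truncated system is invariant under exchanging the two species, so the same argument covers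
   [b]. *)
apply: (cvg_mass0 _ K J S b0 a0 b Np (bN \o Np) (aN \o Np)) => //.
- by move=> i i0 t /(sol_ge0 ab_sol i0)[].
- by move=> p; apply: truncated_solution_swap; exact: N_sol.
- by move=> i t i0 /(ptw i t i0)[].
Qed.
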